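(* Let $\tau\in[0,\frac{\pi}{2}]$, let $\Omega\subset\mathbb{R}^n$ be a domain, let $f$ be a smooth function on $\Omega$, and let $u$ be a smooth function on $\Omega$ such that $F_\tau(\lambda(D^2u(x)))$ is defined for all $x\in\Omega$ and $$F_\tau(\lambda(D^2 u(x)))=f(x),\qquad x\in\Omega.$$ Then $Df(x)$ is the mean curvature of the gradient graph $\{(x,Du(x)):x\in\Omega\}$ in $(\mathbb{R}^n\times\mathbb{R}^n,g_\tau)$, that is, the mean curvature vector of the graph at $(x,Du(x))$ is $\vec H=(Df(x))^{\perp}$, where $Df(x)$ is regarded as the vector $(0,Df(x))=\sum_{l=1}^n f_l(x)\,e_{n+l}$ of $\mathbb{R}^n\times\mathbb{R}^n$.
   Context: $\lambda(D^2u)=(\lambda_1,\dots,\lambda_n)$ are the eigenvalues of the Hessian $D^2u$. With $a=\cot\tau$ and $b=\sqrt{|\cot^2\tau-1|}$ (for $\tau>0$), $$F_{\tau}(\lambda)=\begin{cases}\frac12\sum_{i=1}^n\ln\lambda_i,&\tau=0,\\ \frac{\sqrt{a^2+1}}{2b}\sum_{i=1}^n\ln\frac{\lambda_i+a-b}{\lambda_i+a+b},&0<\tau<\frac{\pi}{4},\\ -\sqrt2\sum_{i=1}^n\frac{1}{1+\lambda_i},&\tau=\frac{\pi}{4},\\ \frac{\sqrt{a^2+1}}{b}\sum_{i=1}^n\arctan\frac{\lambda_i+a-b}{\lambda_i+a+b},&\frac{\pi}{4}<\tau<\frac{\pi}{2},\\ \sum_{i=1}^n\arctan\lambda_i,&\tau=\frac{\pi}{2}.\end{cases}$$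 ''$F_\tau(\lambda)$ is defined'' means that every term of the sum makes sense (denominators nonzero, arguments of logarithms positive). The metric is $g_\tau=\sin\tau\,\delta_0+\cos\tau\,g_0$ on $\mathbb{R}^n\times\mathbb{R}^n$ with coordinates $(x,y)$, where $\delta_0=\sum_i dx_i\otimes dx_i+\sum_j dy_j\otimes dy_j$ and $g_0=\sum_i dx_i\otimes dy_i+\sum_j dy_j\otimes dx_j$ (a constant-coefficient symmetric form, degenerate when $\tau=\pi/4$). Let $e_1,\dots,e_{2n}$ be the standard basis, and $\overline\nabla$ the standard flat connection of $\mathbb{R}^{2n}$. The tangent vectors of the graph are $E_i=e_i+\sum_j u_{ij}e_{n+j}$, $i=1,\dots,n$. The induced metric is $g_{ij}=g_\tau(E_i,E_j)=\sin\tau(\delta_{ij}+\sum_k u_{ik}u_{kj})+2\cos\tau\,u_{ij}$, with inverse $(g^{ij})$. For a vector $V$, $V^\perp$ denotes the component of $V$ in the $g_\tau$-orthogonal complement of $\mathrm{span}(E_1,\dots,E_n)$ (projection along the tangent space; well defined since $(g_{ij})$ is nondegenerate). The mean curvature vector is $\vec H=\sum_{i,j}g^{ij}(\overline\nabla_{E_i}E_j)^\perp$. *)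

(* Defs.v *)
From mathcomp Require Import all_boot all_order all_algebra.
From mathcomp Require Import all_classical all_reals all_analysis.
From mathcomp Require complex.

Set Implicit Arguments.
Unset Strict Implicit.
Unset Printing Implicit Defensive.

Import Order.TTheory GRing.Theory Num.Theory numFieldNormedType.Exports.

Local Open Scope classical_set_scope.
Local Open Scope ring_scope.

Section Calculus.
Variables (R : realType) (n : nat).
Implicit Types (f : 'rV[R]_n -> R) (x : 'rV[R]_n).

Definition domain (Omega : set 'rV[R]_n) : Prop :=
  [/\ open Omega, connected Omega & Omega !=set0].

Definition partial (i : 'I_n) f : 'rV[R]_n -> R :=
  fun x => 'D_(delta_mx 0 i : 'rV[R]_n) f x.

Definition iter_partial (s : seq 'I_n) f : 'rV[R]_n -> R := foldr partial f s.

(* C^infinity on Omega: partial derivatives of all orders exist and are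
   continuous at every point of Omega. For open Omega, this does not depend on
   the values of the total function f outside Omega. *)
Definition smooth_on (Omega : set 'rV[R]_n) f : Prop :=
  forall (s : seq 'I_n) x, Omega x ->
    {for x, continuous (iter_partial s f)} /\
    forall i : 'I_n, derivable (iter_partial s f) x (delta_mx 0 i : 'rV[R]_n).

Definition gradient f x : 'rV[R]_n := \row_i partial i f x.

Definition hessian f x : 'M[R]_n := \matrix_(i, j) partial i (partial j f) x.

End Calculus.

Section Eigenvalues.
Variable R : realType.

(* The eigenvalues (lambda_1, ..., lambda_n) of A, with multiplicity. They
   exist when A is symmetric (eigenvaluesP). Their order is not specified; F
   and F_defined below are symmetric in lambda. *)
Definition eigenvalues n (A : 'M[R]_n) : 'rV[R]_n :=
  get [set lam : 'rV[R]_n | char_poly A = \prod_(i < n) ('X - (lam 0 i)%:P)].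

Import complex.

Lemma eigenvaluesP n (A : 'M[R]_n) : A^T = A ->
  char_poly A = \prod_(i < n) ('X - (eigenvalues A 0 i)%:P).
Proof.
move=> symA; rewrite /eigenvalues; case: xgetP => [lam _ //|noev].
pose B := map_mx (real_complex R) A.
have Bsym : B \is symmetricmx.
  by apply/is_hermitianmxP; rewrite expr0 scale1r map_mx_id // /B map_trmx symA.
have Breal : B \is a mxOver Num.real.
  by apply/mxOverP => i j; rewrite mxE complex_real.
have Bherm := realsym_hermsym Bsym Breal.
have spR := hermitian_spectral_diag_real Bherm.
have /orthomx_spectralP Beq := hermitian_normalmx Bherm.
set P := spectralmx B in Beq; set sp := spectral_diag B in Beq spR.
pose lam : 'rV[R]_n := \row_i complex.Re (sp 0 i).
have spE i : sp 0 i = real_complex R (lam 0 i).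
  by rewrite mxE RRe_real //; apply: (mxOverP spR).
exfalso; apply: (noev lam) => /=.
apply: (map_poly_inj (real_complex R)).
rewrite map_char_poly -/B Beq rmorph_prod /=.
have -> : char_poly (invmx P *m diag_mx sp *m P) = char_poly (diag_mx sp).
  have Pu : P \in unitmx by exact: spectral_unit.
  pose Pc := map_mx polyC P; pose Qc := map_mx polyC (invmx P).
  have QP : Qc *m Pc = 1%:M by rewrite -map_mxM mulVmx // map_mx1.
  rewrite /char_poly; have -> : char_poly_mx (invmx P *m diag_mx sp *m P) =
      Qc *m char_poly_mx (diag_mx sp) *m Pc.
    rewrite /char_poly_mx mulmxBr mulmxBl !map_mxM; congr (_ - _).
    by rewrite mul_mx_scalar -scalemxAl QP scalemx1.
  by rewrite !det_mulmx mulrAC -det_mulmx QP det1 mul1r.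
rewrite char_poly_trig ?diag_mx_is_trig //.
apply: eq_bigr => i _; rewrite !mxE eqxx mulr1n.
by rewrite rmorphB /= map_polyX map_polyC /= spE !mxE.
Qed.

End Eigenvalues.

Section SpecialOperator.
Variable R : realType.
Implicit Type tau : R.

Definition acoef tau : R := cos tau / sin tau.
Definition bcoef tau : R := Num.sqrt `|acoef tau ^+ 2 - 1|.

(* The branches are those of tau = 0, 0 < tau < pi/4, tau = pi/4,
   pi/4 < tau < pi/2 and tau = pi/2, for tau in [0, pi/2]. *)
Definition F n tau (lam : 'rV[R]_n) : R :=
  let a := acoef tau in
  let b := bcoef tau in
  if tau == 0 then 2^-1 * \sum_(i < n) ln (lam 0 i)
  else if tau < pi / 4 then
    Num.sqrt (a ^+ 2 + 1) / (2 * b) *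
      \sum_(i < n) ln ((lam 0 i + a - b) / (lam 0 i + a + b))
  else if tau == pi / 4 then
    - Num.sqrt 2 * \sum_(i < n) (1 + lam 0 i)^-1
  else if tau < pi / 2 then
    Num.sqrt (a ^+ 2 + 1) / b *
      \sum_(i < n) atan ((lam 0 i + a - b) / (lam 0 i + a + b))
  else \sum_(i < n) atan (lam 0 i).

Definition F_defined n tau (lam : 'rV[R]_n) : Prop :=
  let a := acoef tau in
  let b := bcoef tau in
  forall i : 'I_n,
  if tau == 0 then 0 < lam 0 i
  else if tau < pi / 4 then
    (lam 0 i + a + b != 0) && (0 < (lam 0 i + a - b) / (lam 0 i + a + b))
  else if tau == pi / 4 then 1 + lam 0 i != 0
  else if tau < pi / 2 then lam 0 i + a + b != 0
  else true.

End SpecialOperator.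

(* R^n x R^n is 'rV[R]_(n + n): lsubmx and rsubmx give the coordinates x and y,
   and e_i, e_{n+j} are the delta_mx at lshift n i, rshift n j. *)
Section GradientGraph.
Variables (R : realType) (n : nat).
Local Notation vec := 'rV[R]_(n + n).
Implicit Types (tau : R) (u : 'rV[R]_n -> R) (x : 'rV[R]_n) (V W : vec).

Definition ebasis (k : 'I_(n + n)) : vec := delta_mx 0 k.

Definition delta0 V W : R :=
  \sum_(i < n) lsubmx V 0 i * lsubmx W 0 i +
  \sum_(j < n) rsubmx V 0 j * rsubmx W 0 j.

Definition g0 V W : R :=
  \sum_(i < n) lsubmx V 0 i * rsubmx W 0 i +
  \sum_(j < n) rsubmx V 0 j * lsubmx W 0 j.

Definition gmetric tau V W : R := sin tau * delta0 V W + cos tau * g0 V W.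

Definition graph_point u x : vec := row_mx x (gradient u x).

Definition tangent u (i : 'I_n) x : vec :=
  ebasis (lshift n i) + \sum_(j < n) hessian u x i j *: ebasis (rshift n j).

Definition induced_metric tau u x : 'M[R]_n :=
  \matrix_(i, j) gmetric tau (tangent u i x) (tangent u j x).

Definition is_normal_part tau u x V W : Prop :=
  (forall i : 'I_n, gmetric tau W (tangent u i x) = 0) /\
  exists c : 'I_n -> R, V - W = \sum_(i < n) c i *: tangent u i x.

(* Meaningful when the induced metric is nondegenerate (normal_partP). *)
Definition normal_part tau u x V : vec :=
  get [set W | is_normal_part tau u x V W].

Definition flat_connection V (X : vec -> vec) (p : vec) : vec := 'D_V X p.

(* The tangent field E_i is given along the graph; it is extended to
   Omega x R^n independently of y. Differentiating it in a direction tangent to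
   the graph does not depend on the extension. *)
Definition tangent_field u (i : 'I_n) : vec -> vec :=
  fun p => tangent u i (lsubmx p).

Definition mean_curvature tau u x : vec :=
  \sum_(i < n) \sum_(j < n) invmx (induced_metric tau u x) i j *:
    normal_part tau u x
      (flat_connection (tangent u i x) (tangent_field u j) (graph_point u x)).

Definition vertical (v : 'rV[R]_n) : vec :=
  \sum_(l < n) v 0 l *: ebasis (rshift n l).

Lemma gmetric_linl tau W :
  exists D : 'cV[R]_(n + n), forall V, gmetric tau V W = (V *m D) 0 0.
Proof.
pose l := lsubmx W; pose r := rsubmx W.
exists (row_mx (sin tau *: l + cos tau *: r) (sin tau *: r + cos tau *: l))^T.
move=> V; rewrite -[in RHS](hsubmxK V) tr_row_mx mul_row_col !mxE.
rewrite /gmetric /delta0 /g0 !mulrDr !mulr_sumr addrACA -!big_split /=.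
apply: eq_bigr => i _; rewrite !mxE !mulrDr.
by congr ((_ + _) + (_ + _)); rewrite mulrCA.
Qed.

Lemma normal_partP tau u x V W : induced_metric tau u x \in unitmx ->
  is_normal_part tau u x V W <-> normal_part tau u x V = W.
Proof.
set G := induced_metric tau u x => Gu.
pose E i := tangent u i x.
have gE (c : 'I_n -> R) j :
    gmetric tau (\sum_i c i *: E i) (E j) = ((\row_i c i) *m G) 0 j.
  have [D gD] := gmetric_linl tau (E j).
  rewrite gD mulmx_suml summxE !mxE; apply: eq_bigr => i _.
  by rewrite -scalemxAl !mxE gD mxE.
have gB V1 V2 j :
    gmetric tau (V1 - V2) (E j) = gmetric tau V1 (E j) - gmetric tau V2 (E j).
  by have [D gD] := gmetric_linl tau (E j); rewrite !gD mulmxBl !mxE.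
pose w : 'rV[R]_n := (\row_j gmetric tau V (E j)) *m invmx G.
have exW : is_normal_part tau u x V (V - \sum_i w 0 i *: E i).
  split=> [j|]; last by exists (w 0); rewrite subKr.
  rewrite gB gE; have -> : \row_i w 0 i = w by apply/rowP => i; rewrite mxE.
  by rewrite mulmxKV // mxE subrr.
have uniqW W1 W2 : is_normal_part tau u x V W1 ->
    is_normal_part tau u x V W2 -> W1 = W2.
  move=> [N1 [c1 e1]] [N2 [c2 e2]]; apply/eqP; rewrite -subr_eq0; apply/eqP.
  have e : W1 - W2 = \sum_i (c2 i - c1 i) *: E i.
    transitivity ((V - W2) - (V - W1)).
      by rewrite opprB [RHS]addrC addrA subrK.
    by rewrite e1 e2 -sumrB; apply: eq_bigr => i _; rewrite scalerBl.
  have : (\row_i (c2 i - c1 i)) *m G = 0.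
    by apply/rowP => j; rewrite -gE -e gB N1 N2 subrr mxE.
  move/(congr1 (mulmx^~ (invmx G))); rewrite mulmxK // mul0mx => /rowP c0.
  by rewrite e big1 // => i _; have := c0 i; rewrite !mxE => ->; rewrite scale0r.
rewrite /normal_part; case: xgetP => [W0 _ NW0|/(_ _ exW)//].
by split=> [NW|<-//]; exact: uniqW NW0 NW.
Qed.

End GradientGraph.

(* Main.v *)
(* Write A = D^2 u and G = sin tau (1 + A^2) + 2 cos tau A, the matrix of the
   induced metric. Since nabla_{E_i} E_j is vertical with components u_{ijl} and
   third derivatives are symmetric, the claim reduces to
   f_l = tr (G^-1 d_l A).
   The eigenvalues need not be differentiable, so F is differentiated through
   determinants, using that f itself is known to be differentiable. For
   0 < tau <= pi/2, tau <> pi/4, take beta^2 = cot^2 tau - 1, beta being real or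
   imaginary: a suitable exponential of f equals, up to a constant,
   det (A + cot tau - beta) / det (A + cot tau + beta), and
   G = sin tau (A + cot tau + beta) (A + cot tau - beta). In the arctangent case
   the exponential is e^(2 i theta), which is blind to the jumps of the individual
   angles by multiples of pi. For tau = 0 the same is done with det A, and for
   tau = pi/4 with tr (1 + A)^-1 = tr adj (1 + A) / det (1 + A). *)

Require Import Defs.
From mathcomp Require Import all_boot all_order all_algebra.
From mathcomp Require Import all_classical all_reals all_analysis.
From mathcomp Require Import ring lra.
From mathcomp Require complex.

Set Implicit Arguments.
Unset Strict Implicit.
Unset Printing Implicit Defensive.

Import Order.TTheory GRing.Theory Num.Theory numFieldNormedType.Exports.

Local Open Scope classical_set_scope.
Local Open Scope ring_scope.

(** * Symmetry of second derivatives *)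

Section SecondDerivatives.
Variables (R : realType) (V : normedModType R).
Implicit Types (g : V -> R) (v w x : V).

(** The two difference quotients are the same function of [h], so existence and value of the limit
    transfer together. *)
Lemma is_derive_line g v x (t : R) : derivable g (t *: v + x) v ->
  is_derive t 1 (fun s => g (s *: v + x)) ('D_v g (t *: v + x)).
Proof.
have e : (fun h : R => h^-1 *: (g ((h *: (1 : R) + t) *: v + x) - g (t *: v + x)))
  = (fun h => h^-1 *: (g (h *: v + (t *: v + x)) - g (t *: v + x))).
  by apply/funext => h; rewrite [_%:A]mulr1 scalerDl addrA.
by move=> dg; apply: DeriveDef; rewrite /derivable /derive /= e.
Qed.

Lemma MVT_line g v x (h : R) : 0 < h ->
  (forall s, 0 <= s <= h -> derivable g (s *: v + x) v) ->
  exists2 s, 0 <= s <= h & g (h *: v + x) - g x = 'D_v g (s *: v + x) * h.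
Proof.
move=> h0 dg; pose k (s : R) := g (s *: v + x).
have dk s : s \in `[0, h] -> is_derive s 1 k ('D_v g (s *: v + x)).
  by rewrite in_itv => ?; apply/is_derive_line/dg.
have dk' s : s \in `]0, h[ -> is_derive s 1 k ('D_v g (s *: v + x)).
  by move=> sh; apply: dk; exact: subset_itv_oo_cc sh.
have kc : {within `[0, h], continuous k}.
  by apply: derivable_within_continuous => s /dk[].
have [s sh] := MVT_segment (ltW h0) dk' kc.
rewrite subr0 /k scale0r add0r => kE.
by exists s => //; rewrite in_itv in sh.
Qed.

(** The mean value theorem is used twice: for [y |-> g (h *: w + y) - g y] in direction [v], then
    for ['D_v g] in direction [w]. *)
Lemma second_difference g v w x (h : R) : 0 < h ->
  (forall s t, 0 <= s <= h -> 0 <= t <= h ->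
    derivable g (s *: v + (t *: w + x)) v /\
    derivable ('D_v g) (s *: v + (t *: w + x)) w) ->
  exists s t, [/\ 0 <= s <= h, 0 <= t <= h &
    (g (h *: v + (h *: w + x)) - g (h *: w + x)) - (g (h *: v + x) - g x) =
    'D_w ('D_v g) (s *: v + (t *: w + x)) * h * h].
Proof.
move=> h0 dg.
have hh : 0 <= h <= h by rewrite lexx ltW.
have h00 : 0 <= (0 : R) <= h by rewrite lexx ltW.
pose G y := g (h *: w + y) - g y.
have shiftD y : derivable g (h *: w + y) v ->
    is_derive y v (fun y => g (h *: w + y)) ('D_v g (h *: w + y)).
  have e : (fun l : R => l^-1 *: (g (h *: w + (l *: v + y)) - g (h *: w + y)))
    = (fun l => l^-1 *: (g (l *: v + (h *: w + y)) - g (h *: w + y))).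
    by apply/funext => l; rewrite addrCA.
  by move=> d; apply: DeriveDef; rewrite /derivable /derive /= e.
have dG s : 0 <= s <= h -> is_derive (s *: v + x) v G
    ('D_v g (h *: w + (s *: v + x)) - 'D_v g (s *: v + x)).
  move=> sh; apply: is_deriveB.
    by apply: shiftD; rewrite addrCA; exact: (dg _ _ sh hh).1.
  by apply: derivableP; have [] := dg _ _ sh h00; rewrite scale0r add0r.
have [s sh|s sh GE] := MVT_line h0 (g := G) (v := v) (x := x).
  by have [] := dG _ sh.
have [t th|t th DE] := MVT_line h0 (g := 'D_v g) (v := w) (x := s *: v + x).
  by rewrite addrCA; have [] := dg _ _ sh th.
exists s, t; split=> //; rewrite [s *: v + _]addrCA -DE.
have [_ <-] := dG _ sh; rewrite -GE /G.
by rewrite [h *: w + (_ + _)]addrCA; ring.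
Qed.

(** In every small box at [x] spanned by [v] and [w] the two functions share a value, possibly at
    different points; continuity at [x] then bounds [|p x - q x|] by any positive [e]. *)
Lemma eq_of_box_collisions (p q : V -> R) (P : set V) v w x : nbhs x P ->
  {for x, continuous p} -> {for x, continuous q} ->
  (forall h, 0 < h ->
    (forall s t, 0 <= s <= h -> 0 <= t <= h -> P (s *: v + (t *: w + x))) ->
    exists s t s' t', [/\ 0 <= s <= h, 0 <= t <= h, 0 <= s' <= h, 0 <= t' <= h &
      p (s *: v + (t *: w + x)) = q (s' *: v + (t' *: w + x))]) ->
  p x = q x.
Proof.
move=> nP cp cq box; apply/eqP; rewrite -subr_eq0 -normr_le0.
apply/ler_addgt0Pr => e e0; rewrite add0r.
have e2 : 0 < e / 2 by rewrite divr_gt0.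
have np : \forall y \near x, `|p x - p y| < e / 2.
  by apply: cvgr_dist_lt cp _ e2.
have nq : \forall y \near x, `|q x - q y| < e / 2.
  by apply: cvgr_dist_lt cq _ e2.
have /nbhs_ballP[r /= r0 rP] : nbhs x
    (P `&` [set y | `|p x - p y| < e / 2 /\ `|q x - q y| < e / 2]).
  exact: filterI nP (filterI np nq).
(* This makes the box of side [h] lie in the ball of radius [r]. The summand 1 in the denominator
   below keeps it positive when [v] and [w] vanish. *)
have [h h0 hr] : exists2 h, 0 < h & h * `|v| + h * `|w| < r.
  have p0 : 0 < 1 + `|v| + `|w| by rewrite -addrA ltr_wpDr // addr_ge0.
  exists (r / (1 + `|v| + `|w|)); first by rewrite divr_gt0.
  rewrite -mulrDr mulrAC ltr_pdivrMr // ltr_pM2l //.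
  by rewrite -addrA ltrDr.
have {}rP s t : 0 <= s <= h -> 0 <= t <= h ->
    (P `&` [set y | `|p x - p y| < e / 2 /\ `|q x - q y| < e / 2])
      (s *: v + (t *: w + x)).
  move=> /andP[s0 sh] /andP[t0 th]; apply: rP.
  rewrite -ball_normE /= distrC addrA addrK (le_lt_trans (ler_normD _ _)) //.
  by rewrite (le_lt_trans _ hr) // lerD // normrZ ger0_norm // ler_wpM2r.
have [s t sh th|s [t [s' [t' [sh th sh' th' pq]]]]] := box _ h0.
  by have [] := rP _ _ sh th.
have [_ [pP _]] := rP _ _ sh th; have [_ [_ qP]] := rP _ _ sh' th'.
rewrite (le_trans (ler_distD (p (s *: v + (t *: w + x))) _ _)) //.
by rewrite [e]splitr lerD // ?ltW // pq distrC.
Qed.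

(** Schwarz's theorem. The second difference is symmetric in [v] and [w]; evaluated in both orders,
    it gives the mixed derivatives a common value in every small box. *)
Lemma derive_comm g v w x :
  (\forall y \near x, derivable g y v /\ derivable g y w) ->
  (\forall y \near x, derivable ('D_v g) y w /\ derivable ('D_w g) y v) ->
  {for x, continuous ('D_w ('D_v g))} -> {for x, continuous ('D_v ('D_w g))} ->
  'D_w ('D_v g) x = 'D_v ('D_w g) x.
Proof.
move=> d1 d2 c1 c2.
apply: (eq_of_box_collisions (v := v) (w := w) (filterI d1 d2) c1 c2).
move=> h h0 hP.
have [s t sh th|s [t [sh th E1]]] := @second_difference g v w x h h0.
  by have [[d1v _] [d2w _]] := hP _ _ sh th; exact: (conj d1v d2w).
have [s' t' sh' th'|s' [t' [sh' th' E2]]] := @second_difference g w v x h h0.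
  have [[_ d1w] [_ d2v]] := hP _ _ th' sh'.
  by rewrite addrCA; exact: (conj d1w d2v).
exists s, t, t', s'; split; [exact: sh|exact: th|exact: th'|exact: sh'|].
rewrite [t' *: v + _]addrCA.
have hU : h != 0 by rewrite gt_eqF.
apply: (mulIf hU); apply: (mulIf hU); apply: etrans (esym E1) _.
apply: etrans E2; rewrite [h *: w + (h *: v + x)]addrCA.
by ring.
Qed.
End SecondDerivatives.

(** * Complex functions of a real variable *)

Section ComplexDerivative.
Import complex.
Variable R : realType.
Local Notation C := (complex.complex R).
Local Notation RC := (complex.real_complex R).
Implicit Types (f g : R -> C) (t : R).

(** Splitting into real and imaginary parts lets the differentiation rules for real functions be
    applied to each part. *)
Definition is_cderive f t (d : C) : Prop :=
  is_derive t 1 (fun s => complex.Re (f s)) (complex.Re d) /\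
  is_derive t 1 (fun s => complex.Im (f s)) (complex.Im d).

Lemma is_cderive_unique f t d1 d2 :
  is_cderive f t d1 -> is_cderive f t d2 -> d1 = d2.
Proof.
case: d1 d2 => a1 b1 [a2 b2] [/= [_ <-] [_ <-]] [/= [_ <-] [_ <-]] //.
Qed.

Lemma near_eq_is_cderive f g t d :
  (\forall s \near t, f s = g s) -> is_cderive f t d -> is_cderive g t d.
Proof.
move=> fg [dr di]; split.
  by apply: near_eq_is_derive dr; apply: filterS fg => s ->.
by apply: near_eq_is_derive di; apply: filterS fg => s ->.
Qed.

Lemma is_cderive_real (f : R -> R) t d :
  is_derive t 1 f d -> is_cderive (fun s => RC (f s)) t (RC d).
Proof. by move=> df; split=> //=; exact: is_derive_cst. Qed.

Lemma is_cderive_cst c t : is_cderive (fun=> c) t 0.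
Proof. by split; exact: is_derive_cst. Qed.

Lemma is_cderiveD f g t df dg : is_cderive f t df -> is_cderive g t dg ->
  is_cderive (fun s => f s + g s) t (df + dg).
Proof.
have ReD (x y : C) : complex.Re (x + y) = complex.Re x + complex.Re y.
  by case: x y => ? ? [].
have ImD (x y : C) : complex.Im (x + y) = complex.Im x + complex.Im y.
  by case: x y => ? ? [].
move=> [fr fi] [gr gi]; split; rewrite ?ReD ?ImD;
  under eq_fun do rewrite ?ReD ?ImD.
  exact: is_deriveD.
exact: is_deriveD.
Qed.

Lemma is_cderiveM f g t df dg : is_cderive f t df -> is_cderive g t dg ->
  is_cderive (fun s => f s * g s) t (df * g t + f t * dg).
Proof.
have ReM (x y : C) : complex.Re (x * y) =
    complex.Re x * complex.Re y - complex.Im x * complex.Im y.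
  by case: x y => ? ? [].
have ImM (x y : C) : complex.Im (x * y) =
    complex.Re x * complex.Im y + complex.Im x * complex.Re y.
  by case: x y => ? ? [].
move=> [fr fi] [gr gi]; split; under eq_fun do rewrite ?ReM ?ImM.
  apply: (is_derive_eq (is_deriveB (is_deriveM fr gr) (is_deriveM fi gi))).
  by move: (f t) (g t) df dg {fr fi gr gi} => [? ?] [? ?] [? ?] [? ?] /=;
    rewrite /GRing.scale /=; ring.
apply: (is_derive_eq (is_deriveD (is_deriveM fr gi) (is_deriveM fi gr))).
by move: (f t) (g t) df dg {fr fi gr gi} => [? ?] [? ?] [? ?] [? ?] /=;
  rewrite /GRing.scale /=; ring.
Qed.

Lemma is_cderiveMl c f t df : is_cderive f t df ->
  is_cderive (fun s => c * f s) t (c * df).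
Proof.
by move=> /(is_cderiveM (is_cderive_cst c t)); rewrite mul0r add0r.
Qed.

Lemma is_cderive_sum (I : Type) (r : seq I) (f : I -> R -> C) t (d : I -> C) :
  (forall i, is_cderive (f i) t (d i)) ->
  is_cderive (fun s => \sum_(i <- r) f i s) t (\sum_(i <- r) d i).
Proof.
move=> df; elim: r => [|i r IHr].
  by rewrite big_nil; under eq_fun do rewrite big_nil; exact: is_cderive_cst.
by rewrite big_cons; under eq_fun do rewrite big_cons; exact: is_cderiveD.
Qed.

(* In this form of the product rule, the Leibniz expansion of a determinant
   differentiates to a sum of determinants with one row replaced. *)
Lemma is_cderive_prod (I : eqType) (r : seq I) (f : I -> R -> C) t
    (d : I -> C) :
  uniq r -> (forall i, is_cderive (f i) t (d i)) ->
  is_cderive (fun s => \prod_(i <- r) f i s) t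
    (\sum_(i <- r) \prod_(j <- r) (if j == i then d j else f j t)).
Proof.
move=> + df; elim: r => [_|a r IHr /andP[ar ur]].
  by rewrite big_nil; under eq_fun do rewrite big_nil; exact: is_cderive_cst.
under eq_fun do rewrite big_cons.
rewrite big_cons big_cons eqxx (eq_big_seq (fun j => f j t)); last first.
  by move=> j jr; case: eqVneq jr ar => // -> ->.
rewrite [X in _ + X](eq_big_seq (fun i =>
    f a t * \prod_(j <- r) (if j == i then d j else f j t))); last first.
  by move=> i ir; rewrite big_cons; case: eqVneq ir ar => // -> ->.
by rewrite -mulr_sumr; apply: is_cderiveM => //; exact: IHr.
Qed.

(** Jacobi's formula. The Leibniz expansion yields the determinants of [N i], that is [M t] with row
    [i] taken from [B]; expansion along that row leaves the cofactors of [M t], which do not see row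
    [i]. *)
Lemma is_cderive_det n (M : R -> 'M[C]_n) t (B : 'M[C]_n) :
  (forall i j, is_cderive (fun s => M s i j) t (B i j)) ->
  is_cderive (fun s => \det (M s)) t (\tr (B *m \adj (M t))).
Proof.
move=> dM.
pose N i := \matrix_(k, j) (if k == i then B k j else M t k j).
have -> : \tr (B *m \adj (M t)) = \sum_i \det (N i).
  rewrite /mxtrace; apply: eq_bigr => i _; rewrite (expand_det_row _ i) !mxE.
  apply: eq_bigr => j _; rewrite !mxE eqxx /cofactor; congr (_ * (_ * \det _)).
  by apply/matrixP => k l; rewrite !mxE eq_sym (negPf (neq_lift _ _)).
rewrite /determinant exchange_big /=; apply: is_cderive_sum => s.
rewrite -mulr_sumr; apply: is_cderiveMl.
under eq_bigr do under eq_bigr do rewrite mxE.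
by apply: (is_cderive_prod (index_enum_uniq _)) => i; exact: dM.
Qed.
End ComplexDerivative.

(** * Determinants and eigenvalues *)

Lemma horner_char_poly (K : comNzRingType) n (M : 'M[K]_n) (x : K) :
  (char_poly M).[x] = \det (x%:M - M).
Proof.
rewrite -[_.[x]]/(horner_eval x _) /char_poly -det_map_mx.
congr (\det _); apply/matrixP => i j.
rewrite !mxE /= /horner_eval hornerD hornerN hornerC hornerMn hornerX //.
Qed.

Lemma mulmx_shift (K : comNzRingType) n (M : 'M[K]_n) (b c : K) :
  (M + b%:M) *m (M + c%:M) = M *m M + (b + c) *: M + (b * c)%:M.
Proof.
rewrite mulmxDl !mulmxDr !mul_scalar_mx mul_mx_scalar scale_scalar_mx.
by rewrite scalerDl !addrA; congr (_ + _); rewrite addrAC.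
Qed.

(** The factors [M + b] and [M + c] commute, so multiplying the left side by their product leaves
    [(M + b) - (M + c)]. *)
Lemma resolvent_identity (K : fieldType) n (M : 'M[K]_n) (b c : K) :
  M + b%:M \in unitmx -> M + c%:M \in unitmx ->
  invmx (M + c%:M) - invmx (M + b%:M) =
  (b - c) *: invmx ((M + b%:M) *m (M + c%:M)).
Proof.
move=> Ub Uc.
have comm : (M + b%:M) *m (M + c%:M) = (M + c%:M) *m (M + b%:M).
  by rewrite !mulmx_shift [b + c]addrC [b * c]mulrC.
have UK : (M + b%:M) *m (M + c%:M) \in unitmx by rewrite unitmx_mul Ub.
rewrite -[LHS](mulmxK UK) mulmxBl {1}comm !mulKmx //.
rewrite opprD addrACA subrr add0r -raddfB /=.
by rewrite mul_scalar_mx.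
Qed.

(** * Complex shifts of a real symmetric matrix *)

Section ComplexSpectrum.
Import complex.
Variable R : realType.
Local Notation C := (complex.complex R).
Local Notation RC := (complex.real_complex R).

(** Evaluate the factored characteristic polynomial at [- c]; both sides carry the sign [(-1) ^+ n],
    which cancels. *)
Lemma det_shift_eigenvalues n (A : 'M[R]_n) (c : C) : A^T = A ->
  \det (map_mx RC A + c%:M) = \prod_i (RC (eigenvalues A 0 i) + c).
Proof.
move=> /eigenvaluesP /(congr1 (map_poly RC)).
rewrite map_char_poly rmorph_prod => /(congr1 (horner^~ (- c))) /=.
rewrite horner_char_poly raddfN -opprD addrC -scaleN1r detZ horner_prod.
under eq_bigr do
  rewrite rmorphB /= map_polyX map_polyC /= hornerXsubC -opprD addrC.
have U : (-1) ^+ n \is a @GRing.unit C by rewrite unitrX // unitrN1.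
by rewrite prodrN /= card_ord => /(mulrI U).
Qed.

Lemma is_cderive_log_det n (M : R -> 'M[C]_n) t (B : 'M[C]_n) :
  M t \in unitmx -> (forall i j, is_cderive (fun s => M s i j) t (B i j)) ->
  is_cderive (fun s => \det (M s)) t (\det (M t) * \tr (invmx (M t) *m B)).
Proof.
move=> U dM; have := is_cderive_det dM.
by rewrite mxtrace_mulC /invmx U -scalemxAl mxtraceZ mulrA divff ?mul1r //.
Qed.

Lemma is_cderive_shift n (A : R -> 'M[R]_n) (t : R) (B : 'M[R]_n) (c : C) :
  (forall i j, is_derive t 1 (fun s => A s i j) (B i j)) -> forall i j,
  is_cderive (fun s => (map_mx RC (A s) + c%:M) i j) t (map_mx RC B i j).
Proof.
move=> dA i j; under eq_fun do rewrite !mxE; rewrite mxE -[RC _]addr0.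
by apply: is_cderiveD; [exact: is_cderive_real|exact: is_cderive_cst].
Qed.

(** [E] is [k] times the quotient of the two determinants, in multiplied-out form. Its logarithmic
    derivative [w] is a difference of two traces by Jacobi's formula, and the resolvent identity
    merges them into one. *)
Lemma log_derive_det_ratio n (A : R -> 'M[R]_n) (t : R) (B : 'M[R]_n)
    (b c k w : C) (E : R -> C) :
  (forall i j, is_derive t 1 (fun s => A s i j) (B i j)) ->
  (\forall s \near t, E s * \det (map_mx RC (A s) + b%:M) =
    k * \det (map_mx RC (A s) + c%:M)) ->
  is_cderive E t (w * E t) -> E t != 0 ->
  map_mx RC (A t) + b%:M \in unitmx -> map_mx RC (A t) + c%:M \in unitmx ->
  w = (b - c) * \tr (invmx
    ((map_mx RC (A t) + b%:M) *m (map_mx RC (A t) + c%:M)) *m map_mx RC B).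
Proof.
move=> dA eqE dE E0 Ub Uc.
rewrite -mxtraceZ scalemxAl -resolvent_identity // mulmxBl raddfB /=.
have Db := is_cderive_log_det Ub (is_cderive_shift b dA).
have Dc := is_cderive_log_det Uc (is_cderive_shift c dA).
have := near_eq_is_cderive eqE (is_cderiveM dE Db).
move=> /is_cderive_unique/(_ (is_cderiveMl k Dc)).
(* Replacing [k * \det (A + c)] through [eqE] at [t] gives both sides the same nonzero factor
   [E t * D]. *)
rewrite [k * _]mulrA -(nbhs_singleton eqE).
set D := \det _; set x := \tr _; set y := \tr _ => e.
have ED : E t * D != 0 by rewrite mulf_neq0 // -unitfE -unitmxE.
apply: (mulfI ED); rewrite mulrBr -e.
by ring.
Qed.

(* Differentiate [\det (A + c + s)] in [s] at [0], as a determinant and as a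
   product over the eigenvalues. *)
Lemma trace_invmx_shift n (A : 'M[R]_n) (c : C) : A^T = A ->
  map_mx RC A + c%:M \in unitmx ->
  \tr (invmx (map_mx RC A + c%:M)) = \sum_i (RC (eigenvalues A 0 i) + c)^-1.
Proof.
move=> symA U.
have dx (z : C) : is_cderive (fun s : R => RC s + z) 0 1.
  rewrite -[1](addr0 (RC 1)); apply: is_cderiveD; last exact: is_cderive_cst.
  exact: is_cderive_real.
pose M s := map_mx RC A + (RC s + c)%:M.
have M0 : M 0 = map_mx RC A + c%:M by rewrite /M add0r.
have dM i j : is_cderive (fun s => M s i j) 0 (1%:M i j).
  rewrite /M; under eq_fun do rewrite !mxE; rewrite mxE -[_%:R]add0r.
  apply: is_cderiveD; first exact: is_cderive_cst.
  by case: (i == j); [exact: dx|exact: is_cderive_cst].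
have UM : M 0 \in unitmx by rewrite M0.
have D1 := is_cderive_log_det UM dM.
pose z i (s : R) := RC s + (RC (eigenvalues A 0 i) + c).
have D2 : is_cderive (fun s => \det (M s)) 0
    (\sum_i \prod_j (if j == i then 1 else z j 0)).
  have -> : (fun s => \det (M s)) = (fun s => \prod_i z i s).
    apply/funext => s; rewrite /M det_shift_eigenvalues //.
    by apply: eq_bigr => i _; rewrite /z addrCA.
  by apply: (is_cderive_prod (index_enum_uniq _)) => i; exact: dx.
have := is_cderive_unique D1 D2; rewrite mulmx1 M0.
have z0 i : z i 0 = RC (eigenvalues A 0 i) + c by rewrite /z add0r.
have detE : \det (map_mx RC A + c%:M) = \prod_i z i 0.
  by rewrite det_shift_eigenvalues //; apply: eq_bigr => i _; rewrite z0.
have : \prod_i z i 0 != 0 by rewrite -detE -unitfE -unitmxE.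
rewrite detE => /[dup] p0 /prodf_neq0 zn0 e.
apply: (mulfI p0); rewrite e mulr_sumr; apply: eq_bigr => i _.
rewrite (bigD1 i) //= eqxx mul1r [in RHS](bigD1 i) //= z0 mulrAC mulfV ?mul1r.
  by apply: eq_bigr => j /negPf ->.
by rewrite -z0 zn0.
Qed.

End ComplexSpectrum.

(** * Trigonometry *)

Section Angles.
Variable R : realType.
Implicit Types tau : R.

Lemma cos_piquarter : cos (pi / 4) = sin (pi / 4) :> R.
Proof.
have := tan_piquarter R; rewrite /tan => /divr1_eq //.
Qed.

Lemma sin_gt0_pihalfW tau : 0 < tau <= pi / 2 -> 0 < sin tau.
Proof.
move=> /andP[t0 t1]; apply: sin_gt0_pi; rewrite t0 /=.
by rewrite (le_lt_trans t1) // ltr_pdivrMr // ltr_pMr ?pi_gt0 // ltr1n.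
Qed.

(** From [1 + cot^2 = 1 / sin^2]; this simplifies the constants in front of the sums in [F]. *)
Lemma sqrt_acoef tau : 0 < tau <= pi / 2 ->
  Num.sqrt (acoef tau ^+ 2 + 1) = (sin tau)^-1.
Proof.
move=> /sin_gt0_pihalfW s0.
have -> : acoef tau ^+ 2 + 1 = (sin tau)^-1 ^+ 2.
  rewrite /acoef exprMn -[1](mulfV (_ : sin tau ^+ 2 != 0)) ?expf_neq0 ?gt_eqF //.
  by rewrite exprVn -mulrDl cos2Dsin2 mul1r.
by rewrite sqrtr_sqr ger0_norm // invr_ge0 ltW.
Qed.

(** Cosine decreases, sine increases, and they agree at [pi / 4]. This bound and the next one fix
    the sign inside the absolute value in [bcoef]. *)
Lemma acoef_gt1 tau : 0 < tau < pi / 4 -> 1 < acoef tau.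
Proof.
move=> /andP[t0 t1]; have p0 := pi_gt0 R.
have s0 : 0 < sin tau by apply: sin_gt0_pihalfW; lra.
rewrite /acoef ltr_pdivlMr // mul1r.
have cI : (pi / 4 : R) \in `[0, pi] by rewrite in_itv /=; lra.
have tI : tau \in `[0, pi] by rewrite in_itv /=; lra.
have cI' : (pi / 4 : R) \in `[- (pi / 2), pi / 2] by rewrite in_itv /=; lra.
have tI' : tau \in `[- (pi / 2), pi / 2] by rewrite in_itv /=; lra.
have : cos (pi / 4) < cos tau by rewrite ltr_cos.
have : sin tau < sin (pi / 4) by rewrite ltr_sin.
by rewrite cos_piquarter; exact: lt_trans.
Qed.

Lemma acoef_ge0_lt1 tau : pi / 4 < tau <= pi / 2 -> 0 <= acoef tau < 1.
Proof.
move=> /andP[t0 t1]; have p0 := pi_gt0 R.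
have s0 : 0 < sin tau by apply: sin_gt0_pihalfW; lra.
have c0 : 0 <= cos tau by apply: cos_ge0_pihalf; lra.
rewrite /acoef ltr_pdivrMr // mul1r divr_ge0 ?(ltW s0) //=.
have cI : (pi / 4 : R) \in `[0, pi] by rewrite in_itv /=; lra.
have tI : tau \in `[0, pi] by rewrite in_itv /=; lra.
have cI' : (pi / 4 : R) \in `[- (pi / 2), pi / 2] by rewrite in_itv /=; lra.
have tI' : tau \in `[- (pi / 2), pi / 2] by rewrite in_itv /=; lra.
have : cos tau < cos (pi / 4) by rewrite ltr_cos.
have : sin (pi / 4) < sin tau by rewrite ltr_sin.
by rewrite cos_piquarter => /[swap]; exact: lt_trans.
Qed.

Lemma acoef_piquarter : acoef (pi / 4 : R) = 1.
Proof.
have p0 := pi_gt0 R.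
by rewrite /acoef cos_piquarter divff // gt_eqF // sin_gt0_pihalfW //; lra.
Qed.

End Angles.

(** * Unit complex numbers and the arctangent *)

Section PhaseFactor.
Import complex.
Variable R : realType.
Local Notation C := (complex.complex R).
Local Notation RC := (complex.real_complex R).

(** This is e^(i x). *)
Definition cis (x : R) : C := RC (cos x) + 'i%C * RC (sin x).

Lemma cis0 : cis 0 = 1.
Proof. by rewrite /cis cos0 sin0 rmorph0 mulr0 addr0 rmorph1. Qed.

Lemma cisD x y : cis (x + y) = cis x * cis y.
Proof.
rewrite /cis cosD sinD rmorphB rmorphD !rmorphM /=.
have := sqr_i R; set i := 'i%C => ii.
transitivity (RC (cos x) * RC (cos y) + i ^+ 2 * (RC (sin x) * RC (sin y)) +
   i * (RC (sin x) * RC (cos y) + RC (cos x) * RC (sin y))); last by ring.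
by rewrite ii mulN1r.
Qed.

Lemma cis_neq0 x : cis x != 0.
Proof.
apply: contraNneq (oner_neq0 C) => c0.
by rewrite -cis0 -(subrr x) cisD c0 mul0r.
Qed.

Lemma cis_sum (I : Type) (r : seq I) (f : I -> R) :
  cis (\sum_(i <- r) f i) = \prod_(i <- r) cis (f i).
Proof. exact: (big_morph cis cisD cis0). Qed.

Lemma is_cderive_cis (g : R -> R) (t dg : R) : is_derive t 1 g dg ->
  is_cderive (fun s => cis (g s)) t ('i%C * RC dg * cis (g t)).
Proof.
move=> Dg.
have -> : 'i%C * RC dg * cis (g t) =
    RC (- sin (g t) * dg) + 'i%C * RC (cos (g t) * dg).
  rewrite /cis !rmorphM rmorphN /=.
  have := sqr_i R; set i := 'i%C => ii.
  transitivity (i ^+ 2 * (RC (sin (g t)) * RC dg) + i * (RC (cos (g t)) * RC dg)).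
    by ring.
  by rewrite ii mulN1r mulNr.
by apply: is_cderiveD; last apply: is_cderiveMl; apply: is_cderive_real.
Qed.

(** The Cayley transform. With [c = cos (atan q)] one has [sin (atan q) = q c], so e^(2 i atan q) is
    c^2 (1 + i q)^2, while 1 = c^2 (1 + i q) (1 - i q). *)
Lemma cis_atan (q : R) : cis (2 * atan q) * (1 - 'i%C * RC q) = 1 + 'i%C * RC q.
Proof.
have cn0 : cos (atan q) != 0.
  by rewrite cos_atan invr_neq0 // gt_eqF // sqrtr_gt0 ltr_pwDl // sqr_ge0.
have sE : sin (atan q) = q * cos (atan q) by rewrite -{2}[q]atanK divfK.
have := cos2Dsin2 (atan q); rewrite mulr_natl mulr2n cisD /cis sE.
set c := cos (atan q) => cE.
have /(congr1 RC) := cE; rewrite rmorph1 rmorphD !rmorphXn !rmorphM /=.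
have := sqr_i R; set i := 'i%C => ii /= cE'.
transitivity ((1 + i * RC q) * (RC c ^+ 2 - i ^+ 2 * (RC q * RC c) ^+ 2)).
  by ring.
by rewrite ii mulN1r opprK cE' mulr1.
Qed.

End PhaseFactor.

(** * Differentiating the special operators *)

Definition metric_mx (R : realType) n (tau : R) (A : 'M[R]_n) : 'M[R]_n :=
  sin tau *: (1%:M + A *m A) + (2 * cos tau) *: A.

Section PhaseBranches.
Import complex.
Variables (R : realType) (n : nat) (A : R -> 'M[R]_n) (t : R) (B : 'M[R]_n).
Variables (f : R -> R) (d : R) (tau : R).
Local Notation C := (complex.complex R).
Local Notation RC := (complex.real_complex R).
Local Notation lam s i := (eigenvalues (A s) 0 i).
Hypothesis dA : forall i j, is_derive t 1 (fun s => A s i j) (B i j).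
Hypothesis df : is_derive t 1 f d.
Hypothesis symA : \forall s \near t, (A s)^T = A s.

Let symAt : (A t)^T = A t. Proof. exact: nbhs_singleton symA. Qed.

(** Common core of the branches with nonzero [beta], real or imaginary. The shifts [a + beta] and
    [a - beta] have product 1 and sum [2 a], whence [G = sin tau (A + a + beta) (A + a - beta)]. The
    trace formula is proved over the complex numbers and descends to the reals by injectivity. *)
Lemma derive_of_phase (beta k : C) (E : R -> C) : sin tau != 0 -> beta != 0 ->
  RC (acoef tau) ^+ 2 - beta ^+ 2 = 1 ->
  is_cderive E t (2 * beta * RC (sin tau) * RC d * E t) -> E t != 0 ->
  (\forall s \near t, E s * \prod_i (RC (lam s i) + (RC (acoef tau) + beta)) =
    k * \prod_i (RC (lam s i) + (RC (acoef tau) - beta))) ->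
  (forall i, RC (lam t i) + (RC (acoef tau) + beta) != 0) ->
  (forall i, RC (lam t i) + (RC (acoef tau) - beta) != 0) ->
  metric_mx tau (A t) \in unitmx /\
  d = \tr (invmx (metric_mx tau (A t)) *m B).
Proof.
set a := acoef tau => s0 b0 ab dE E0 eqE p0 m0.
have unit_shift (c : C) : (forall i, RC (lam t i) + c != 0) ->
    map_mx RC (A t) + c%:M \in unitmx.
  move=> c0; rewrite unitmxE unitfE det_shift_eigenvalues //.
  by apply/prodf_neq0 => i _.
have Up := unit_shift _ p0; have Um := unit_shift _ m0.
have GE : map_mx RC (metric_mx tau (A t)) = RC (sin tau) *:
    ((map_mx RC (A t) + (RC a + beta)%:M) *m (map_mx RC (A t) + (RC a - beta)%:M)).
  have bc : (RC a + beta) * (RC a - beta) = 1 by rewrite mulrC -subr_sqr.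
  have bDc : RC (sin tau) * (RC a + beta + (RC a - beta)) = RC (2 * cos tau).
    rewrite addrACA subrr addr0 -rmorphD -rmorphM /a /acoef; congr (RC _).
    by field.
  rewrite mulmx_shift bc /metric_mx map_mxD !map_mxZ map_mxD map_mxM map_mx1.
  by rewrite addrAC [RHS]scalerDr scalerA bDc [1%:M + _]addrC.
have RCs0 : RC (sin tau) != 0 by rewrite fmorph_eq0.
have UG : metric_mx tau (A t) \in unitmx.
  by rewrite -(map_unitmx RC) GE unitmxZ ?unitfE // unitmx_mul Up.
split=> //; apply: (@complexI R).
rewrite -[RHS]trace_map_mx map_mxM map_invmx GE invmxZ -?GE ?map_unitmx //.
rewrite -scalemxAl mxtraceZ; apply: (mulfI RCs0); rewrite mulVKf //.
(* [2 * beta] is the difference of the two shifts, the factor [b - c] of [log_derive_det_ratio]. *)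
apply: (mulfI (_ : 2 * beta != 0)); first by rewrite mulf_neq0 ?pnatr_eq0.
have eqD : \forall s \near t,
    E s * \det (map_mx RC (A s) + (RC a + beta)%:M) =
    k * \det (map_mx RC (A s) + (RC a - beta)%:M).
  by apply: filterS2 symA eqE => s symAs; rewrite !det_shift_eigenvalues.
rewrite mulrA (log_derive_det_ratio dA eqD dE E0 Up Um).
by rewrite opprD opprK addrACA subrr add0r -mulr2n mulr_natl.
Qed.

(** Here [beta] is [i b], and [E] is e^(2 i theta) with theta the sum of the arctangents. Each
    eigenvalue contributes the same constant [k], hence [k ^+ n]. The shifted eigenvalues have
    imaginary part [b] or [- b], so they do not vanish. *)
Lemma derive_of_angle (b : R) (q : R -> 'I_n -> R) (k : C) :
  0 < sin tau -> 0 < b -> acoef tau ^+ 2 + b ^+ 2 = 1 ->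
  (\forall s \near t, f s = (sin tau)^-1 / b * \sum_i atan (q s i)) ->
  (\forall s \near t, forall i,
    cis (2 * atan (q s i)) * (RC (lam s i) + (RC (acoef tau) + 'i%C * RC b)) =
    k * (RC (lam s i) + (RC (acoef tau) - 'i%C * RC b))) ->
  metric_mx tau (A t) \in unitmx /\
  d = \tr (invmx (metric_mx tau (A t)) *m B).
Proof.
set a := acoef tau => s0 b0 ab fE qE.
have lam0 s i (c : R) : c != 0 -> RC (lam s i) + (RC a + 'i%C * RC c) != 0.
  apply: contraNneq => /(congr1 (@complex.Im R)) /= h.
  by apply/eqP; rewrite -[RHS]h; ring.
apply: (@derive_of_phase ('i%C * RC b) (k ^+ n)
    (fun s => cis (2 * sin tau * b * f s))).
- by rewrite gt_eqF.
- by rewrite mulf_neq0 // ?fmorph_eq0 ?(gt_eqF b0) // eq_complex /= oner_eq0 andbF.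
- by rewrite exprMn sqr_i mulN1r opprK -!rmorphXn -rmorphD ab rmorph1.
- have -> : 2 * ('i%C * RC b) * RC (sin tau) * RC d =
      'i%C * RC (2 * sin tau * b * d).
    by rewrite !rmorphM rmorph_nat /=; ring.
  exact: is_cderive_cis.
- exact: cis_neq0.
- apply: filterS2 fE qE => s -> qs.
  have -> : 2 * sin tau * b * ((sin tau)^-1 / b * \sum_i atan (q s i)) =
      \sum_i 2 * atan (q s i).
    by rewrite -mulr_sumr; field; rewrite ?gt_eqF.
  rewrite cis_sum -big_split /= (eq_bigr _ (fun i _ => qs i)) big_split /=.
  by rewrite prodr_const card_ord.
- by move=> i; apply: lam0; rewrite gt_eqF.
- by move=> i; rewrite -mulrN -rmorphN; apply: lam0; rewrite oppr_eq0 gt_eqF.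
Qed.

End PhaseBranches.

(** * The logarithmic branches and the case tau = pi/4 *)

Section LogarithmicBranches.
Import complex.
Variables (R : realType) (n : nat) (A : R -> 'M[R]_n) (t : R) (B : 'M[R]_n).
Variables (f : R -> R) (d : R) (tau : R).
Local Notation C := (complex.complex R).
Local Notation RC := (complex.real_complex R).
Local Notation lam s i := (eigenvalues (A s) 0 i).
Hypothesis dA : forall i j, is_derive t 1 (fun s => A s i j) (B i j).
Hypothesis df : is_derive t 1 f d.
Hypothesis symA : \forall s \near t, (A s)^T = A s.

Let symAt : (A t)^T = A t. Proof. exact: nbhs_singleton symA. Qed.

(** Here [beta] is the real number [b], and [E], the exponential of [2 sin tau b f], is the product
    of the quotients, so [k = 1]. A positive quotient has a nonzero numerator. *)
Lemma derive_of_log (b : R) :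
  0 < sin tau -> 0 < b -> acoef tau ^+ 2 - b ^+ 2 = 1 ->
  (\forall s \near t, forall i, lam s i + acoef tau + b != 0 /\
    0 < (lam s i + acoef tau - b) / (lam s i + acoef tau + b)) ->
  (\forall s \near t, f s = (sin tau)^-1 / (2 * b) *
    \sum_i ln ((lam s i + acoef tau - b) / (lam s i + acoef tau + b))) ->
  metric_mx tau (A t) \in unitmx /\
  d = \tr (invmx (metric_mx tau (A t)) *m B).
Proof.
set a := acoef tau => s0 b0 ab qP fE.
have RCE s i (c : R) : RC (lam s i) + (RC a + RC c) = RC (lam s i + a + c).
  by rewrite !rmorphD addrA.
have RCE' s i : RC (lam s i) + (RC a - RC b) = RC (lam s i + a - b).
  by rewrite -rmorphN RCE.
apply: (derive_of_phase dA symA (beta := RC b) (k := 1)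
    (E := fun s => RC (expR (2 * sin tau * b * f s)))).
- by rewrite gt_eqF.
- by rewrite fmorph_eq0 gt_eqF.
- by rewrite -!rmorphXn -rmorphB ab rmorph1.
- have -> : 2 * RC b * RC (sin tau) * RC d * RC (expR (2 * sin tau * b * f t)) =
      RC (expR (2 * sin tau * b * f t) * (2 * sin tau * b * d)).
    by rewrite !rmorphM rmorph_nat /=; ring.
  by apply: is_cderive_real; exact: is_derive1_comp.
- by rewrite fmorph_eq0 gt_eqF // expR_gt0.
- apply: filterS2 qP fE => s qs ->.
  have -> : 2 * sin tau * b * ((sin tau)^-1 / (2 * b) *
      \sum_i ln ((lam s i + a - b) / (lam s i + a + b))) =
      \sum_i ln ((lam s i + a - b) / (lam s i + a + b)).
    by field; rewrite ?gt_eqF.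
  rewrite expR_sum rmorph_prod -big_split /= mul1r; apply: eq_bigr => i _.
  have [p0 r0] := qs i.
  by rewrite lnK // RCE RCE' -rmorphM divfK.
- move=> i; rewrite RCE fmorph_eq0.
  by have [] := nbhs_singleton qP i.
- move=> i; rewrite RCE' fmorph_eq0.
  have [_] := nbhs_singleton qP i.
  by apply: contraTneq => ->; rewrite mul0r ltxx.
Qed.

(** Now [G = 2 A] and the exponential of [2 f] is [\det A]; Jacobi's formula gives
    [2 d = \tr (A^-1 B)]. *)
Lemma derive_of_log_det : tau = 0 ->
  (\forall s \near t, forall i, 0 < lam s i) ->
  (\forall s \near t, f s = 2^-1 * \sum_i ln (lam s i)) ->
  metric_mx tau (A t) \in unitmx /\
  d = \tr (invmx (metric_mx tau (A t)) *m B).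
Proof.
move=> -> lP fE; rewrite /metric_mx sin0 cos0 scale0r add0r mulr1.
have detE s : (A s)^T = A s -> RC (\det (A s)) = \prod_i RC (lam s i).
  move=> sA; rewrite -det_map_mx -[map_mx _ _]addr0 -(raddf0 (scalar_mx)).
  rewrite det_shift_eigenvalues //.
  by under eq_bigr do rewrite addr0.
have UA : A t \in unitmx.
  rewrite unitmxE unitfE -(fmorph_eq0 RC) /= detE //.
  apply/prodf_neq0 => i _; rewrite fmorph_eq0 gt_eqF //.
  exact: (nbhs_singleton lP).
have UCA : map_mx RC (A t) \in unitmx by rewrite map_unitmx.
have U2 : (2 : R) \is a GRing.unit by rewrite unitfE.
have U2A : 2 *: A t \in unitmx by rewrite unitmxZ.
split=> //; rewrite invmxZ // -scalemxAl mxtraceZ.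
have dCA i j : is_cderive (fun s => map_mx RC (A s) i j) t (map_mx RC B i j).
  by under eq_fun do rewrite mxE; rewrite mxE; exact: is_cderive_real.
have D1 := is_cderive_log_det UCA dCA.
have D2 : is_cderive (fun s => RC (expR (2 * f s))) t
    (RC (expR (2 * f t) * (2 * d))).
  by apply: is_cderive_real; exact: is_derive1_comp.
have eqE : \forall s \near t, RC (expR (2 * f s)) = \det (map_mx RC (A s)).
  apply: filterS3 symA lP fE => s sA l0 ->.
  rewrite mulrA mulfV // mul1r expR_sum det_map_mx /= detE // rmorph_prod.
  apply: eq_bigr => i _; rewrite lnK //; exact: l0.
have := is_cderive_unique (near_eq_is_cderive eqE D2) D1.
rewrite -(nbhs_singleton eqE) rmorphM -map_invmx -map_mxM trace_map_mx.
move=> /mulfI; rewrite fmorph_eq0 gt_eqF ?expR_gt0 // => /(_ isT).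
by move=> /complexI <-; rewrite mulKf.
Qed.

(** With [M = 1 + A] one has [G = sin tau M^2] and [f = - (sin tau)^-1 \tr M^-1]. Differentiating
    [f \det M = k \tr (\adj M)] yields [- k \tr (M^-1 B M^-1)] for [d], which is the claimed trace
    by cyclicity. *)
Lemma derive_of_trace_inv : 0 < sin tau -> acoef tau = 1 ->
  (\forall s \near t, forall i, 1 + lam s i != 0) ->
  (\forall s \near t, f s = - (sin tau)^-1 * \sum_i (1 + lam s i)^-1) ->
  metric_mx tau (A t) \in unitmx /\
  d = \tr (invmx (metric_mx tau (A t)) *m B).
Proof.
move=> s0 a1 lP fE.
pose M s := map_mx RC (A s) + 1%:M.
pose k := RC (- (sin tau)^-1).
have UM s : (A s)^T = A s -> (forall i, 1 + lam s i != 0) -> M s \in unitmx.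
  move=> sA l0; rewrite unitmxE unitfE det_shift_eigenvalues //.
  by apply/prodf_neq0 => i _; rewrite -(rmorph1 RC) -rmorphD fmorph_eq0 addrC.
have UMt := UM _ symAt (nbhs_singleton lP).
have dM := is_cderive_shift 1 dA.
have detM0 : \det (M t) != 0 by rewrite -unitfE -unitmxE.
have D1 := is_cderive_log_det UMt dM.
set x := \tr _ in D1.
have trE s : (A s)^T = A s -> (forall i, 1 + lam s i != 0) ->
    RC (\sum_i (1 + lam s i)^-1) = \tr (invmx (M s)).
  move=> sA l0; rewrite trace_invmx_shift //; last exact: UM.
  rewrite rmorph_sum; apply: eq_bigr => i _.
  by rewrite fmorphV rmorphD rmorph1 addrC.
have adjE s : M s \in unitmx -> \adj (M s) = \det (M s) *: invmx (M s).
  by move=> U; rewrite /invmx U scalerA mulfV ?scale1r.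
(* The derivative of the adjugate exists since it is polynomial in [M]; its
   value follows from [\adj M *m M = \det M]. *)
have [D dD] : exists D : 'M[C]_n,
    forall i j, is_cderive (fun s => \adj (M s) i j) t (D i j).
  exists (\matrix_(i, j) ((-1) ^+ (j + i) *
      \tr (row' j (col' i (map_mx RC B)) *m \adj (row' j (col' i (M t)))))).
  move=> i j; rewrite mxE; under eq_fun do rewrite mxE /cofactor.
  apply: is_cderiveMl.
  apply: (is_cderive_det (M := fun s => row' j (col' i (M s)))) => i' j'.
  by under eq_fun do rewrite 2!mxE; rewrite 2!mxE; exact: dM.
have DE : D *m M t + \adj (M t) *m map_mx RC B = (\det (M t) * x)%:M.
  apply/matrixP => i j; rewrite 3!mxE -big_split /=.
  have L : is_cderive (fun s => (\adj (M s) *m M s) i j) t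
      (\sum_k (D i k * M t k j + \adj (M t) i k * map_mx RC B k j)).
    under eq_fun do rewrite mxE.
    by apply: is_cderive_sum => l; exact: is_cderiveM.
  apply: is_cderive_unique L _; under eq_fun do rewrite mul_adj_mx mxE.
  by rewrite [X in is_cderive _ _ X]mxE; case: (i == j);
    [exact: D1|exact: is_cderive_cst].
(* Solve [DE] for [D] by multiplying with [invmx (M t)] on the right, then take traces. *)
have trD : \tr D = \det (M t) * (x * \tr (invmx (M t)) -
    \tr (invmx (M t) *m map_mx RC B *m invmx (M t))).
  have -> : D = (\det (M t) * x) *: invmx (M t) -
      \adj (M t) *m map_mx RC B *m invmx (M t).
    by rewrite -mul_scalar_mx -DE mulmxDl mulmxK // addrK.
  by rewrite raddfB /= mxtraceZ adjE // -!scalemxAl mxtraceZ mulrBr mulrA.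
have eqE : \forall s \near t, RC (f s) * \det (M s) = k * \tr (\adj (M s)).
  apply: filterS3 symA lP fE => s sA l0 ->.
  rewrite rmorphM /= -/k adjE ?mxtraceZ; last exact: UM.
  by rewrite trE // -mulrA [\tr _ * _]mulrC.
have Dl := is_cderiveM (is_cderive_real df) D1.
have Dr : is_cderive (fun s => k * \tr (\adj (M s))) t (k * \tr D).
  by apply: is_cderiveMl; apply: is_cderive_sum.
have := is_cderive_unique (near_eq_is_cderive eqE Dl) Dr.
rewrite trD (nbhs_singleton fE) rmorphM /= -/k trE //; last exact: nbhs_singleton lP.
rewrite -/(M t) [k * (_ * _)]mulrCA => e.
(* The terms containing [x], which come from the derivative of the determinant, are equal on the two
   sides and cancel. *)
have {e} : RC d = - k * \tr (invmx (M t) *m map_mx RC B *m invmx (M t)).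
  by apply: (mulfI detM0); move: e; set z := \tr (_ *m _); set y := \tr _ => e;
    rewrite [LHS]mulrC -[LHS](addrK (k * y * (\det (M t) * x))) e; ring.
rewrite mxtrace_mulC mulmxA => dE.
have GE : map_mx RC (metric_mx tau (A t)) = RC (sin tau) *: (M t *m M t).
  rewrite /metric_mx map_mxD !map_mxZ map_mxD map_mxM map_mx1 mulmx_shift.
  have -> : 2 * cos tau = sin tau * 2.
    by move: a1 => /divr1_eq ->; rewrite mulrC.
  rewrite rmorphM rmorph_nat mulr1 -scalerA -scalerDr -addrA.
  by congr (_ *: _); rewrite [RHS]addrC.
have RCs0 : RC (sin tau) \is a GRing.unit by rewrite unitfE fmorph_eq0 gt_eqF.
have UMM : M t *m M t \in unitmx by rewrite unitmx_mul UMt.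
have UG : metric_mx tau (A t) \in unitmx.
  by rewrite -(map_unitmx RC) GE unitmxZ.
split=> //; apply: (@complexI R).
rewrite -[RHS]trace_map_mx map_mxM map_invmx GE invmxZ; last first.
  by rewrite unitmxZ.
have -> : invmx (M t *m M t) = invmx (M t) *m invmx (M t).
  rewrite -[RHS](mulmxK UMM) -[invmx _ *m _ *m _]mulmxA mulKmx // mulVmx //.
  by rewrite mul1mx.
by rewrite dE -scalemxAl mxtraceZ /k rmorphN opprK fmorphV.
Qed.

End LogarithmicBranches.

(** * All branches of the operator together *)

Section DeriveF.
Import complex.
Variable R : realType.
Local Notation C := (complex.complex R).
Local Notation RC := (complex.real_complex R).

(** Each branch of [F] is matched to one of the preceding lemmas: the position of [tau] relative to
    [pi / 4] decides the sign of [a ^+ 2 - 1], and thus whether [b ^+ 2] is [a ^+ 2 - 1] or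
    [1 - a ^+ 2]. *)
Lemma derive_F n (A : R -> 'M[R]_n) (t : R) (B : 'M[R]_n)
    (f : R -> R) (d tau : R) :
  0 <= tau <= pi / 2 ->
  (forall i j, is_derive t 1 (fun s => A s i j) (B i j)) ->
  is_derive t 1 f d ->
  (\forall s \near t, (A s)^T = A s) ->
  (\forall s \near t, F_defined tau (eigenvalues (A s))) ->
  (\forall s \near t, F tau (eigenvalues (A s)) = f s) ->
  metric_mx tau (A t) \in unitmx /\
  d = \tr (invmx (metric_mx tau (A t)) *m B).
Proof.
move=> /andP[t0 t1] dA df symA; rewrite /F_defined /F.
set a := acoef tau; set b := bcoef tau.
case: (eqVneq tau 0) => [tau0 dF eF|tn0].
  apply: derive_of_log_det dA df symA tau0 dF _.
  by apply: filterS eF => s <-.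
have {}t0 : 0 < tau by rewrite lt0r tn0.
have ht : 0 < tau <= pi / 2 by rewrite t0.
have s0 := sin_gt0_pihalfW ht.
rewrite (sqrt_acoef ht).
have p0 := pi_gt0 R.
have [t4 dF eF|t4|t4] := ltgtP tau (pi / 4).
- have a1 : 1 < a by apply: acoef_gt1; rewrite t0.
  have a2 : 0 < a ^+ 2 - 1 by rewrite subr_gt0 expr_gt1 // ltW // (lt_trans ltr01).
  have b2 : b ^+ 2 = a ^+ 2 - 1.
    by rewrite /b /bcoef -/a sqr_sqrtr // gtr0_norm.
  have b0 : 0 < b by rewrite sqrtr_gt0 normr_gt0 gt_eqF.
  apply: (derive_of_log dA df symA s0 b0); first by rewrite b2 -/a; ring.
    by apply: filterS dF => s ds i; apply/andP; exact: ds.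
  by apply: filterS eF => s <-.
- have ab : 0 <= a < 1 by apply: acoef_ge0_lt1; rewrite t4.
  have [a0 a1] := andP ab.
  have a2 : a ^+ 2 - 1 < 0 by rewrite subr_lt0 expr_lt1.
  have b2 : b ^+ 2 = 1 - a ^+ 2.
    by rewrite /b /bcoef -/a sqr_sqrtr // ltr0_norm // opprB.
  have b0 : 0 < b by rewrite sqrtr_gt0 normr_gt0 lt_eqF.
  have ab1 : a ^+ 2 + b ^+ 2 = 1 by rewrite b2; ring.
  case: ltP => t2 dF eF.
    (* For q = (l + a - b) / (l + a + b), 1 + i q and 1 - i q are proportional to (1 + i) (l + a - i
       b) and (1 - i) (l + a + i b); so [k] is (1 + i) / (1 - i) = i. *)
    apply: (derive_of_angle dA df symA s0 b0 ab1
      (q := fun s i => (eigenvalues (A s) 0 i + a - b) /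
        (eigenvalues (A s) 0 i + a + b))
      (k := 'i%C)).
      by apply: filterS eF => s <-.
    apply: filterS dF => s ds i; move: (ds i); set l := eigenvalues (A s) 0 i => l0.
    set q := _ / _.
    have := cis_atan q; have := sqr_i R; set I := 'i%C => II ce.
    have lq : (RC l + RC a + RC b) * RC q = RC l + RC a - RC b.
      by rewrite -!rmorphD -rmorphM -rmorphB /q mulrC divfK.
    have L0 : RC l + RC a + RC b != 0 by rewrite -!rmorphD fmorph_eq0.
    have I1 : 1 - I != 0.
      by rewrite eq_complex /= !subr0 oner_eq0.
    (* The factor [1 - I] turns l + a + i b into (l + a + b) (1 - i q), to which [cis_atan]
       applies. *)
    apply: (mulfI I1).
    transitivity (cis (2 * atan q) * ((1 - I) * (RC l + RC a) + (I - I ^+ 2) * RC b)).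
      by ring.
    rewrite II.
    transitivity (cis (2 * atan q) * (1 - I * RC q) * (RC l + RC a + RC b)).
      by rewrite -mulrA; congr (_ * _);
        rewrite [RHS]mulrBl mul1r -mulrA [RC q * _]mulrC lq; ring.
    rewrite ce mulrDl mul1r -mulrA [RC q * _]mulrC lq.
    transitivity ((I - I ^+ 2) * (RC l + RC a) - (I ^+ 2 - I ^+ 2 * I) * RC b); last by ring.
    by rewrite II; ring.
  have tE : tau = pi / 2 by apply/le_anti; rewrite t1 t2.
  have a00 : a = 0 by rewrite /a /acoef tE cos_pihalf mul0r.
  have sE : sin tau = 1 by rewrite tE sin_pihalf.
  have b1 : (0 : R) < 1 by [].
  have ab1' : a ^+ 2 + 1 ^+ 2 = 1 by rewrite a00 expr0n add0r expr1n.
  (* With [a = 0] and [b = 1] the argument of the arctangent is the eigenvalue q itself, and 1 + i q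
     = i (q - i), 1 - i q = - i (q + i) give [k = -1]. *)
  apply: (derive_of_angle dA df symA s0 b1 ab1'
      (q := fun s i => eigenvalues (A s) 0 i) (k := -1)).
    by apply: filterS eF => s <-; rewrite sE !invr1 !mul1r.
  apply: filterS symA => s _ i; set q := eigenvalues _ _ _.
  rewrite -/a a00 rmorph0 rmorph1 !add0r mulr1.
  have := cis_atan q; have := sqr_i R; set I := 'i%C => II ce.
  transitivity (I * (cis (2 * atan q) * (1 - I * RC q)) +
      cis (2 * atan q) * (1 + I ^+ 2) * RC q); first by ring.
  rewrite ce II subrr mulr0 mul0r addr0.
  by transitivity (I + I ^+ 2 * RC q); [ring|rewrite II; ring].
- move=> dF eF.
  have a1 : a = 1 by rewrite /a t4 acoef_piquarter.
  apply: (derive_of_trace_inv dA df symA s0 a1 dF).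
  apply: filterS eF => s <-.
  (* The constants agree: [(sin tau)^-1] is the square root of [a ^+ 2 + 1], here of 2. *)
  by rewrite -(sqrt_acoef ht) -/a a1 expr1n.
Qed.

End DeriveF.

(** * The gradient graph *)

Section Smooth.
Variables (R : realType) (n : nat).
Implicit Types (Omega : set 'rV[R]_n) (u : 'rV[R]_n -> R) (x : 'rV[R]_n).

Lemma smooth_on_partial Omega u j :
  smooth_on Omega u -> smooth_on Omega (partial j u).
Proof.
by move=> su s x Ox; have := su (rcons s j) x Ox; rewrite /iter_partial foldr_rcons.
Qed.

Lemma partial_comm Omega u i j x : open Omega -> smooth_on Omega u -> Omega x ->
  partial i (partial j u) x = partial j (partial i u) x.
Proof.
move=> oO su Ox; have nO : nbhs x Omega by exact: open_nbhs_nbhs.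
apply: derive_comm.
- apply: filterS nO => y Oy.
  by have [_ d] := su [::] y Oy; exact: (conj (d j) (d i)).
- apply: filterS nO => y Oy; have [_ dj] := su [:: j] y Oy.
  by have [_ di] := su [:: i] y Oy; exact: (conj (dj i) (di j)).
- by have [c _] := su [:: i; j] x Ox; exact: c.
- by have [c _] := su [:: j; i] x Ox; exact: c.
Qed.

Lemma hessian_sym Omega u x : open Omega -> smooth_on Omega u -> Omega x ->
  (hessian u x)^T = hessian u x.
Proof.
move=> oO su Ox; apply/matrixP => i j; rewrite !mxE.
exact: partial_comm oO su Ox.
Qed.

(** Reversal is a product of three adjacent swaps: inner, outer, inner. An inner swap is
    differentiated once more, so it must hold in a neighbourhood of [x]. *)
Lemma partial3_perm Omega u i j l x : open Omega -> smooth_on Omega u -> Omega x ->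
  partial i (partial j (partial l u)) x = partial l (partial j (partial i u)) x.
Proof.
move=> oO su Ox.
have near_comm a b c : partial a (partial b (partial c u)) x =
    partial a (partial c (partial b u)) x.
  apply: near_eq_derive; apply: filterS (open_nbhs_nbhs (conj oO Ox)) => y Oy.
  exact: partial_comm oO su Oy.
rewrite near_comm (partial_comm _ _ oO (smooth_on_partial j su) Ox).
exact: near_comm.
Qed.

End Smooth.

(** * Tangent vectors, the induced metric and normal parts *)

Section Graph.
Variables (R : realType) (n : nat).
Local Notation vec := 'rV[R]_(n + n).
Implicit Types (tau : R) (u : 'rV[R]_n -> R) (x : 'rV[R]_n) (V p : vec).

Lemma verticalE (v : 'rV[R]_n) : vertical v = row_mx 0 v.
Proof.
apply/rowP => k; rewrite summxE; case: (split_ordP k) => l ->.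
  rewrite row_mxEl mxE big1 // => j _.
  by rewrite !mxE /= eq_lrshift mulr0.
rewrite row_mxEr (bigD1 l) //= big1 => [|j jl].
  by rewrite !mxE !eqxx mulr1 addr0.
by rewrite !mxE /= eq_rshift eq_sym (negPf jl) mulr0.
Qed.

Lemma tangentE u i x :
  tangent u i x = row_mx (delta_mx 0 i) (row i (hessian u x)).
Proof.
have -> : tangent u i x = row_mx (delta_mx 0 i) 0 + vertical (row i (hessian u x)).
  congr (_ + _); last by apply: eq_bigr => j _; rewrite !mxE.
  apply/rowP => k; rewrite !mxE; case: (split_ordP k) => l ->; rewrite !mxE /=.
    by rewrite eq_lshift.
  by rewrite eq_rlshift.
by rewrite verticalE add_row_mx addr0 add0r.
Qed.

(** Symmetry turns the product of rows [i] and [j] into an entry of the squared Hessian, and makes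
    the two mixed terms of [g0] equal. *)
Lemma induced_metricE tau u x : (hessian u x)^T = hessian u x ->
  induced_metric tau u x = metric_mx tau (hessian u x).
Proof.
move=> symH; apply/matrixP => i j; rewrite [LHS]mxE /gmetric /delta0 /g0.
rewrite !tangentE !row_mxKl !row_mxKr.
move: (hessian u x) symH => H symH.
have sH a b : H a b = H b a by rewrite -{1}symH mxE.
have deltaE (a b : 'I_n) : (delta_mx 0 a : 'rV[R]_n) 0 b = (b == a)%:R.
  by rewrite mxE.
have sumL (g : 'I_n -> R) a :
    \sum_k (delta_mx 0 a : 'rV[R]_n) 0 k * g k = g a.
  rewrite (bigD1 a) //= big1 => [|k ki]; rewrite deltaE.
    by rewrite eqxx mul1r addr0.
  by rewrite (negPf ki) mul0r.
rewrite !sumL deltaE eq_sym.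
under [X in _ + cos tau * (_ + X)]eq_bigr do rewrite mulrC.
rewrite sumL ![row _ _ _ _]mxE (sH j i) !mxE [in RHS]eq_sym; congr (_ * (_ + _) + _).
  by apply: eq_bigr => k _; rewrite !mxE (sH j).
by ring.
Qed.

(** The two conditions defining a normal part are stable under linear combinations, and
    nondegeneracy makes the vector satisfying them unique. *)
Lemma normal_part_sum tau u x (I : finType) (c : I -> R) (V : I -> vec) :
  induced_metric tau u x \in unitmx ->
  normal_part tau u x (\sum_i c i *: V i) =
  \sum_i c i *: normal_part tau u x (V i).
Proof.
move=> U.
have P i : is_normal_part tau u x (V i) (normal_part tau u x (V i)).
  exact/(normal_partP _ _ U).
apply/(normal_partP _ _ U); split=> [j|].
  have [D gD] := gmetric_linl tau (tangent u j x).
  rewrite gD mulmx_suml summxE big1 // => i _.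
  have [/(_ j) + _] := P i; rewrite gD => gi.
  by rewrite -scalemxAl mxE gi mulr0.
have [e eE] := choice (fun i => (P i).2).
exists (fun k => \sum_i c i * e i k).
under [RHS]eq_bigr do rewrite scaler_suml.
rewrite exchange_big -sumrB; apply: eq_bigr => i _.
rewrite -scalerBr eE scaler_sumr.
by apply: eq_bigr => k _; rewrite scalerA.
Qed.

Lemma derive_lsubmx (W : normedModType R) (X : 'rV[R]_n -> W) V p :
  'D_V (fun q => X (lsubmx q)) p = 'D_(lsubmx V) X (lsubmx p).
Proof.
have e : (fun h : R => h^-1 *: (X (lsubmx (h *: V + p)) - X (lsubmx p))) =
    (fun h => h^-1 *: (X (h *: lsubmx V + lsubmx p) - X (lsubmx p))).
  by apply/funext => h; rewrite linearP.
by rewrite /derive /= e.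
Qed.

(** The extended field depends on the base point alone, so only the base part of [E_i], a standard
    basis vector, differentiates it; the base part of [E_j] is constant. *)
Lemma flat_connection_tangent Omega u i j x :
  open Omega -> smooth_on Omega u -> Omega x ->
  flat_connection (tangent u i x) (tangent_field u j) (graph_point u x) =
  vertical (\row_l partial i (partial j (partial l u)) x).
Proof.
move=> oO su Ox.
have -> : flat_connection (tangent u i x) (tangent_field u j) (graph_point u x) =
    'D_(delta_mx 0 i) (tangent u j) x.
  by rewrite [LHS]derive_lsubmx tangentE !row_mxKl.
have entry (k : 'I_(n + n)) : is_derive x (delta_mx 0 i) (fun y => tangent u j y 0 k)
    (vertical (\row_l partial i (partial j (partial l u)) x) 0 k).
  rewrite verticalE; under eq_fun do rewrite tangentE.
  case: (split_ordP k) => l ->; rewrite ?row_mxEl ?row_mxEr.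
    by under eq_fun do rewrite row_mxEl;
      rewrite [X in is_derive _ _ _ X]mxE;
      exact: is_derive_cst.
  under eq_fun do rewrite row_mxEr !mxE; rewrite mxE.
  apply: derivableP; have [_ d] := su [:: j; l] x Ox; exact: d.
have dT : derivable (tangent u j) x (delta_mx 0 i).
  by apply/derivable_mxP => a k; rewrite (ord1 a); have [] := entry k.
apply/rowP => k; rewrite (derive_mx dT) mxE.
by have [_ ->] := entry k.
Qed.

End Graph.

Theorem proposition1p1 (R : realType) (n : nat) (tau : R)
    (Omega : set 'rV[R]_n) (f u : 'rV[R]_n -> R)
    (htau : 0 <= tau <= pi / 2)
    (hOmega : domain Omega)
    (hf : smooth_on Omega f)
    (hu : smooth_on Omega u)
    (hdef : forall x, Omega x -> F_defined tau (eigenvalues (hessian u x)))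
    (heq : forall x, Omega x -> F tau (eigenvalues (hessian u x)) = f x) :
  forall x, Omega x ->
    mean_curvature tau u x = normal_part tau u x (vertical (gradient f x)).
Proof.
move=> x Ox; have [oO _ _] := hOmega.
have symH := hessian_sym oO hu Ox.
pose third l : 'M[R]_n := \matrix_(i, j) partial l (partial i (partial j u)) x.
(* Differentiate the equation along the line through [x] in direction [e_l], at parameter 0. *)
have key l : induced_metric tau u x \in unitmx /\
    partial l f x = \tr (invmx (induced_metric tau u x) *m third l).
  rewrite induced_metricE //.
  pose e : 'rV[R]_n := delta_mx 0 l.
  have x0 : 0 *: e + x = x by rewrite scale0r add0r.
  have nO : \forall s \near (0 : R), Omega (s *: e + x).
    have : {for (0 : R), continuous (fun s : R => s *: e + x)}.
      by apply: cvgD; [exact: scalel_continuous|exact: cvg_cst].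
    by apply; rewrite x0; exact: open_nbhs_nbhs.
  rewrite -[in metric_mx _ _]x0.
  apply: (derive_F (A := fun s => hessian u (s *: e + x)) htau
    (f := fun s => f (s *: e + x))).
  - move=> i j; under eq_fun do rewrite mxE.
    rewrite mxE -[X in partial l _ X]x0; apply: is_derive_line.
    by rewrite x0; have [_ d] := hu [:: i; j] x Ox; exact: d.
  - rewrite -[X in partial l _ X]x0; apply: is_derive_line.
    by rewrite x0; have [_ d] := hf [::] x Ox; exact: d.
  - by apply: filterS nO => s; exact: hessian_sym.
  - by apply: filterS nO => s; exact: hdef.
  - by apply: filterS nO => s; exact: heq.
(* [key] gives invertibility of the metric only through an index [l]. For [n = 0] the ambient
   vectors have no entries, so the claim is immediate. *)
case: (posnP n) => [n0|n0].
  by apply/rowP => -[k kn]; exfalso; move: kn; rewrite n0.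
have U := (key (Ordinal n0)).1.
rewrite /mean_curvature pair_big /=.
under eq_bigr do rewrite (flat_connection_tangent _ _ oO hu Ox).
(* Linearity moves the projection outside the sum, which leaves an identity between vertical
   vectors. *)
rewrite -(normal_part_sum (fun p => invmx (induced_metric tau u x) p.1 p.2)) //.
congr (normal_part tau u x _).
have -> : gradient f x = \sum_(p : 'I_n * 'I_n)
    invmx (induced_metric tau u x) p.1 p.2 *:
    \row_l partial p.1 (partial p.2 (partial l u)) x.
  apply/rowP => l; rewrite summxE mxE (key l).2 /mxtrace.
  under eq_bigr do rewrite mxE.
  rewrite pair_big; apply: eq_bigr => -[i j] _ /=; rewrite !mxE.
  (* The trace pairs entry [i j] of the inverse metric with entry [j i] of [third l], so the order
     of the three derivatives has to be reversed. *)
  by rewrite (partial3_perm i j l oO hu Ox).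
rewrite verticalE.
under eq_bigr do rewrite verticalE scale_row_mx scaler0.
apply/rowP => k; rewrite summxE; case: (split_ordP k) => l ->.
  by rewrite row_mxEl mxE big1 // => p _; rewrite row_mxEl mxE.
by rewrite row_mxEr summxE; apply: eq_bigr => p _; rewrite row_mxEr.
Qed.
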